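(* In the axiomatic system $Z + AC_{\aleph_0}$ (Zermelo set theory without Replacement and Foundation, together with the Axiom of Countable Choice), the following is provable: for every set $X$, the following four conditions are equivalent to each other: (1) $X$ is Standard Infinite; (2) $X$ is Cardinal Infinite, i.e. $card(X) \geq \aleph_0$; (3) $X$ is Cantor Infinite; (4) $X$ is Dedekind Infinite.
   Context: The system $Z$ is the first-order theory with equality and one binary predicate $\in$ (all objects are sets, no atoms), with the axioms: Extensionality; Null Set (existence of $\emptyset$); Pair Set; Union Set; Infinity (there is an inductive set: a set containing $\emptyset$ and closed under $a \mapsto a \cup \{a\}$); Power Set; and the axiom schema of restricted Comprehension (for every set $a$ and every formula $\varphi(x,u_1,\dots,u_n)$ with parameters $u_i$, the set $\{x \in a : \varphi(x,u_1,\dots,u_n)\}$ exists). The axioms of Replacement, Foundation and Choice are not included in $Z$. $AC_{\aleph_0}$ (Axiom of Countable Choice): for every set $b$ and every binary relation $P \subseteq \omega \times b$, if for all $n \in \omega$ there is $y \in b$ with $P(n,y)$, then there is $f : \omega \to b$ with $P(n,f(n))$ for all $n \in \omega$. Here $\omega = \mathbb{N}$ is the least inductive set; its elements are the natural numbers, and $n = \{0,\dots,n-1\}$. Two sets are equipotent if there is a bijection between them. A set is finite if it is equipotent to some $n \in \omega$, and countable if it is equipotent to $\omega$. A set $X$ is: - Standard Infinite if it is not finite; - Cardinal Infinite if $card(X) \geq \aleph_0$, i.e. there is an injection $\omega \to X$; - Cantor Infinite if it contains a countable subset (a subset equipotent to $\omega$); - Dedekind Infinite if it contains a proper subset $B \subset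 X$ equipotent to $X$. *)

(* Defs.v *)
From Stdlib Require Import List PeanoNat.

(** * First-order logic with equality and one binary predicate

    The language has no function symbols, so the only terms are variables,
    given by de Bruijn indices: [Mem i j] is "variable i ∈ variable j", and
    [All] binds index [0]. *)

Inductive form : Type :=
| Bot : form
| Eq : nat -> nat -> form
| Mem : nat -> nat -> form
| Imp : form -> form -> form
| All : form -> form.

Definition Neg (p : form) : form := Imp p Bot.
Definition And (p q : form) : form := Neg (Imp p (Neg q)).
Definition Or (p q : form) : form := Imp (Neg p) q.
Definition Iff (p q : form) : form := And (Imp p q) (Imp q p).
Definition Ex (p : form) : form := Neg (All (Neg p)).

Definition up (r : nat -> nat) (i : nat) : nat :=
  match i with 0 => 0 | S k => S (r k) end.

Fixpoint rename (r : nat -> nat) (p : form) : form :=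
  match p with
  | Bot => Bot
  | Eq i j => Eq (r i) (r j)
  | Mem i j => Mem (r i) (r j)
  | Imp p q => Imp (rename r p) (rename r q)
  | All p => All (rename (up r) p)
  end.

Definition shift : form -> form := rename S.

(** [inst t p] substitutes the variable [t] for index [0], as when the
    quantifier of [All p] is removed. *)
Definition inst (t : nat) : form -> form :=
  rename (fun i => match i with 0 => t | S k => k end).

(** Classical natural deduction. *)

Inductive prf : list form -> form -> Prop :=
| prf_ax G p : In p G -> prf G p
| prf_impI G p q : prf (p :: G) q -> prf G (Imp p q)
| prf_impE G p q : prf G (Imp p q) -> prf G p -> prf G q
| prf_raa G p : prf (Neg p :: G) Bot -> prf G p
| prf_allI G p : prf (map shift G) p -> prf G (All p)
| prf_allE G p t : prf G (All p) -> prf G (inst t p)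
| prf_eqI G i : prf G (Eq i i)
| prf_eqE G i j p : prf G (Eq i j) -> prf G (inst i p) -> prf G (inst j p).

Definition provable (T : form -> Prop) (p : form) : Prop :=
  exists G : list form, (forall q, In q G -> T q) /\ prf G p.

(** All free indices of [p] are smaller than [bound p]. *)
Fixpoint bound (p : form) : nat :=
  match p with
  | Bot => 0
  | Eq i j | Mem i j => Nat.max (S i) (S j)
  | Imp p q => Nat.max (bound p) (bound q)
  | All p => Nat.pred (bound p)
  end.

Definition closure (p : form) : form := Nat.iter (bound p) All p.

(** * Named variables

    To write concrete sentences with named binders, a variable is here the
    number of quantifiers in whose scope its own binder stands (its de Bruijn
    level). A [pform] yields a formula once told the number [d] of enclosing
    quantifiers, at which point level [x] becomes the index [d - S x]. *)

Definition var : Type := nat.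
Definition pform : Type := nat -> form.

Definition peq (x y : var) : pform := fun d => Eq (d - S x) (d - S y).
Definition pmem (x y : var) : pform := fun d => Mem (d - S x) (d - S y).
Definition pneg (A : pform) : pform := fun d => Neg (A d).
Definition pand (A B : pform) : pform := fun d => And (A d) (B d).
Definition por (A B : pform) : pform := fun d => Or (A d) (B d).
Definition pimp (A B : pform) : pform := fun d => Imp (A d) (B d).
Definition piff (A B : pform) : pform := fun d => Iff (A d) (B d).
Definition pall (A : var -> pform) : pform := fun d => All (A d (S d)).
Definition pex (A : var -> pform) : pform := fun d => Ex (A d (S d)).

Definition sentence (A : pform) : form := A 0.

Declare Scope pform_scope.
Delimit Scope pform_scope with pform.
Bind Scope pform_scope with pform.

Notation "x ≐ y" := (peq x y) (at level 70) : pform_scope.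
Notation "x ∈ y" := (pmem x y) (at level 70) : pform_scope.
Notation "¬ A" := (pneg A) (at level 75, right associativity) : pform_scope.
Notation "A ∧ B" := (pand A B) (at level 80, right associativity) : pform_scope.
Notation "A ∨ B" := (por A B) (at level 85, right associativity) : pform_scope.
Notation "A ⟶ B" := (pimp A B)
  (at level 90, B at level 200, right associativity) : pform_scope.
Notation "A ⟷ B" := (piff A B) (at level 95, no associativity) : pform_scope.
Notation "∀ x .. y , A" := (pall (fun x => .. (pall (fun y => A)) ..))
  (at level 200, x binder, y binder, right associativity) : pform_scope.
Notation "∃ x .. y , A" := (pex (fun x => .. (pex (fun y => A)) ..))
  (at level 200, x binder, y binder, right associativity) : pform_scope.

Local Open Scope pform_scope.

(** * Set-theoretic notions *)

Definition subset (a b : var) : pform := ∀ x, x ∈ a ⟶ x ∈ b.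
Definition proper_subset (a b : var) : pform := subset a b ∧ ¬ (a ≐ b).

Definition is_empty (e : var) : pform := ∀ x, ¬ (x ∈ e).
(** c = {a, b} *)
Definition is_pair (c a b : var) : pform := ∀ x, x ∈ c ⟷ (x ≐ a ∨ x ≐ b).
(** u = ⋃ a *)
Definition is_union (u a : var) : pform := ∀ x, x ∈ u ⟷ (∃ y, y ∈ a ∧ x ∈ y).
(** p = 𝒫(a) *)
Definition is_power (p a : var) : pform := ∀ x, x ∈ p ⟷ subset x a.
(** s = a ∪ {a} *)
Definition is_succ (s a : var) : pform := ∀ x, x ∈ s ⟷ (x ∈ a ∨ x ≐ a).

Definition inductive (i : var) : pform :=
  (∃ e, is_empty e ∧ e ∈ i) ∧
  (∀ a, a ∈ i ⟶ ∃ s, is_succ s a ∧ s ∈ i).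

Definition is_omega (w : var) : pform :=
  inductive w ∧ (∀ i, inductive i ⟶ subset w i).

(** p = (x, y) = {{x}, {x, y}}, the Kuratowski pair *)
Definition is_opair (p x y : var) : pform :=
  ∃ s t, is_pair s x x ∧ is_pair t x y ∧ is_pair p s t.

(** (x, y) ∈ r *)
Definition related (r x y : var) : pform := ∃ p, is_opair p x y ∧ p ∈ r.

(** r ⊆ a × b *)
Definition is_relation (r a b : var) : pform :=
  ∀ p, p ∈ r ⟶ ∃ x y, x ∈ a ∧ y ∈ b ∧ is_opair p x y.

(** f : a → b, a function being identified with its graph *)
Definition is_function (f a b : var) : pform :=
  is_relation f a b ∧
  (∀ x, x ∈ a ⟶ ∃ y, related f x y) ∧
  (∀ x y z, related f x y ⟶ related f x z ⟶ y ≐ z).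

Definition is_injection (f a b : var) : pform :=
  is_function f a b ∧
  (∀ x y z, related f x z ⟶ related f y z ⟶ x ≐ y).

Definition is_bijection (f a b : var) : pform :=
  is_injection f a b ∧ (∀ y, y ∈ b ⟶ ∃ x, related f x y).

Definition equipotent (a b : var) : pform := ∃ f, is_bijection f a b.

Definition finite (X : var) : pform :=
  ∃ w, is_omega w ∧ (∃ n, n ∈ w ∧ equipotent X n).
Definition countable (X : var) : pform := ∃ w, is_omega w ∧ equipotent X w.

Definition standard_infinite (X : var) : pform := ¬ finite X.
Definition cardinal_infinite (X : var) : pform :=
  ∃ w, is_omega w ∧ (∃ f, is_injection f w X).
Definition cantor_infinite (X : var) : pform :=
  ∃ B, subset B X ∧ countable B.
Definition dedekind_infinite (X : var) : pform :=
  ∃ B, proper_subset B X ∧ equipotent B X.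

(** * The theory Z + AC_ℵ₀ *)

Definition ax_extensionality : form :=
  sentence (∀ a b, (∀ x, x ∈ a ⟷ x ∈ b) ⟶ a ≐ b).
Definition ax_null : form := sentence (∃ e, is_empty e).
Definition ax_pair : form := sentence (∀ a b, ∃ c, is_pair c a b).
Definition ax_union : form := sentence (∀ a, ∃ u, is_union u a).
Definition ax_infinity : form := sentence (∃ i, inductive i).
Definition ax_power : form := sentence (∀ a, ∃ p, is_power p a).

(** In [p], index [0] stands for x and the indices [S k] for the parameters.
    Under the quantifiers ∀ a ∃ y ∀ x the sets x, y, a have indices 0, 1, 2,
    so the parameters move up to the indices [3 + k]. *)
Definition ax_comprehension (p : form) : form :=
  closure (All (Ex (All
    (Iff (Mem 0 1)
         (And (Mem 0 2)
              (rename (fun i => match i with 0 => 0 | S k => 3 + k end) p)))))).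

Definition ax_countable_choice : form :=
  sentence (∀ w, is_omega w ⟶ ∀ b P,
    is_relation P w b ⟶
    (∀ n, n ∈ w ⟶ ∃ y, y ∈ b ∧ related P n y) ⟶
    ∃ f, is_function f w b ∧
      (∀ n, n ∈ w ⟶ ∃ y, related f n y ∧ related P n y)).

Inductive Z_axiom : form -> Prop :=
| Z_extensionality : Z_axiom ax_extensionality
| Z_null : Z_axiom ax_null
| Z_pair : Z_axiom ax_pair
| Z_union : Z_axiom ax_union
| Z_infinity : Z_axiom ax_infinity
| Z_power : Z_axiom ax_power
| Z_comprehension p : Z_axiom (ax_comprehension p).

Definition Z_ACω (q : form) : Prop := Z_axiom q \/ q = ax_countable_choice.

(* Main.v *)
From Stdlib Require Import List PeanoNat Lia Cantor.
From Stdlib Require Import Classical ClassicalEpsilon.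
From Stdlib Require Import FunctionalExtensionality PropExtensionality ProofIrrelevance.
Require Import Defs.

(** By the completeness theorem for classical natural deduction
    ([completeness]) it is enough to prove the equivalences in an arbitrary
    structure [(M, mem)] that satisfies the axioms, where they become ordinary
    mathematics about a relation on a type. Completeness is proved by Henkin's
    method: a sentence that is not derivable has a negation consistent with
    the axioms, this theory extends to a maximal consistent one in which every
    refuted universal formula has a counterexample, and the variables modulo
    provable equality form a model of the extension. As the theory consists of
    sentences, all variables are free to serve as Henkin constants.

    In a structure the natural numbers may be non-standard, so induction on
    them, like separation, is available only for properties that are definable
    by formulas with parameters. The predicate [definable] on predicates of the
    metalanguage is closed under the logical operations, and so its instances
    are found by syntactic search.

    The equivalences are proved as a cycle.

    Standard to Cardinal ([cardinal_of_standard]): if [X] is not finite, then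
    an injection of [n] into [X] is never onto, so by induction every [n]
    injects into [X]. Countable choice selects an injection [phi_k] of [k + 1]
    into [X] for each [k] at once. By recursion, let the value at [k] be the
    first entry of [phi_k] that is not among the [k] earlier values; it exists
    by the pigeonhole principle. The values are distinct by construction.

    Cardinal to Cantor ([cantor_of_cardinal]): take the range of the injection.

    Cantor to Dedekind ([dedekind_of_cantor]): shift the countable subset by
    one and fix all other points; the image misses one point.

    Dedekind to Standard ([standard_of_dedekind]): if [X] were equipotent to
    [n], an injection of [X] into [X] that misses a point would give one of
    [n + 1] into [n], against the pigeonhole principle. *)

(** * Renaming and derivations *)

Definition scons {A : Type} (x : A) (r : nat -> A) (i : nat) : A :=
  match i with 0 => x | S k => r k end.

Lemma rename_agree p : forall r s,
  (forall i, i < bound p -> r i = s i) -> rename r p = rename s p.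
Proof.
  induction p as [|i j|i j|p IHp q IHq|p IHp]; intros r s E; simpl in *.
  - reflexivity.
  - rewrite (E i), (E j) by lia. reflexivity.
  - rewrite (E i), (E j) by lia. reflexivity.
  - rewrite (IHp r s), (IHq r s) by (intros; apply E; lia). reflexivity.
  - f_equal. apply IHp. intros [|i] Hi; simpl; [reflexivity|].
    f_equal. apply E. lia.
Qed.

Lemma rename_id p : rename (fun i => i) p = p.
Proof.
  induction p as [|i j|i j|p IHp q IHq|p IHp]; simpl; try congruence.
  f_equal. rewrite <- IHp at 2. apply rename_agree. now intros [|i].
Qed.

Lemma rename_rename p : forall r s,
  rename r (rename s p) = rename (fun i => r (s i)) p.
Proof.
  induction p as [|i j|i j|p IHp q IHq|p IHp]; intros r s; simpl;
    try reflexivity.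
  - now rewrite IHp, IHq.
  - f_equal. rewrite IHp. apply rename_agree. now intros [|i].
Qed.

Lemma rename_closed r p : bound p = 0 -> rename r p = p.
Proof.
  intros H. rewrite <- (rename_id p) at 2. apply rename_agree. lia.
Qed.

Lemma rename_up_shift r p : rename (up r) (shift p) = shift (rename r p).
Proof. unfold shift. now rewrite !rename_rename. Qed.

Lemma rename_inst r t p : rename r (inst t p) = inst (r t) (rename (up r) p).
Proof.
  unfold inst. rewrite !rename_rename. apply rename_agree. now intros [|i].
Qed.

Lemma inst_up t r p : inst t (rename (up r) p) = rename (scons t r) p.
Proof.
  unfold inst. rewrite rename_rename. apply rename_agree. now intros [|i].
Qed.

Lemma prf_weaken G p : prf G p -> forall G', incl G G' -> prf G' p.
Proof.
  induction 1 as [G p Hp|G p q _ IH|G p q _ IH1 _ IH2|G p _ IH|G p _ IH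
                 |G p t _ IH|G i|G i j p _ IH1 _ IH2]; intros G' HG.
  - apply prf_ax; auto.
  - apply prf_impI, IH. intros x [->|Hx]; [now left|right; auto].
  - apply prf_impE with p; auto.
  - apply prf_raa, IH. intros x [->|Hx]; [now left|right; auto].
  - apply prf_allI, IH. now apply incl_map.
  - apply prf_allE; auto.
  - apply prf_eqI.
  - apply prf_eqE with i; auto.
Qed.

Lemma prf_rename G p : prf G p ->
  forall r, prf (map (rename r) G) (rename r p).
Proof.
  induction 1 as [G p Hp|G p q _ IH|G p q _ IH1 _ IH2|G p _ IH|G p _ IH
                 |G p t _ IH|G i|G i j p _ IH1 _ IH2]; intros r; simpl in *.
  - now apply prf_ax, in_map.
  - apply prf_impI, IH.
  - apply prf_impE with (rename r p); [apply IH1|apply IH2].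
  - apply prf_raa, IH.
  - apply prf_allI. specialize (IH (up r)). rewrite map_map in *.
    erewrite map_ext; [exact IH|]. intros q. symmetry. apply rename_up_shift.
  - rewrite rename_inst. apply prf_allE, IH.
  - apply prf_eqI.
  - rewrite rename_inst. apply prf_eqE with (r i); [apply IH1|].
    rewrite <- rename_inst. apply IH2.
Qed.

(** Renaming [k] to the eigenvariable [0] and every other [i] to [S i] turns
    the given derivation into one to which [prf_allI] applies. *)
Lemma prf_fresh_allI G p k :
  (forall q, In q G -> bound q <= k) -> bound (All p) <= k ->
  prf G (inst k p) -> prf G (All p).
Proof.
  intros HG Hp H. apply prf_allI.
  apply prf_rename with (r := fun i => if Nat.eq_dec i k then 0 else S i) in H.
  replace (map shift G) with
    (map (rename (fun i => if Nat.eq_dec i k then 0 else S i)) G).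
  - replace p with
      (rename (fun i => if Nat.eq_dec i k then 0 else S i) (inst k p)); [exact H|].
    unfold inst. rewrite rename_rename.
    rewrite <- (rename_id p) at 2. apply rename_agree. simpl in Hp.
    intros [|i] Hi; destruct Nat.eq_dec; lia.
  - apply map_ext_in. intros q Hq. apply rename_agree. intros i Hi.
    specialize (HG q Hq). destruct Nat.eq_dec; lia.
Qed.

(** * Theories *)

Definition add (T : form -> Prop) (p q : form) : Prop := T q \/ q = p.
Definition consistent (T : form -> Prop) : Prop := ~ provable T Bot.

Lemma provable_ax (T : form -> Prop) p : T p -> provable T p.
Proof.
  intros H. exists (p :: nil). split.
  - intros q [<-|[]]. exact H.
  - apply prf_ax. now left.
Qed.

Lemma provable_mono (T U : form -> Prop) p :
  (forall q, T q -> U q) -> provable T p -> provable U p.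
Proof. intros HTU (G & HG & H). exists G. auto. Qed.

Lemma provable_prf1 T p q :
  (forall G, prf G p -> prf G q) -> provable T p -> provable T q.
Proof. intros R (G & HG & H). exists G. auto. Qed.

Lemma provable_prf2 T p q r :
  (forall G, prf G p -> prf G q -> prf G r) ->
  provable T p -> provable T q -> provable T r.
Proof.
  intros R (G1 & HG1 & H1) (G2 & HG2 & H2). exists (G1 ++ G2). split.
  - intros s Hs. apply in_app_or in Hs as []; auto.
  - apply R; eapply prf_weaken; eauto using incl_appl, incl_appr, incl_refl.
Qed.

Lemma provable_impE T p q : provable T (Imp p q) -> provable T p -> provable T q.
Proof. apply provable_prf2. intros G. apply prf_impE. Qed.

Lemma add_assumptions T p G : (forall q, In q G -> add T p q) ->
  exists G', (forall q, In q G' -> T q) /\ incl G (p :: G').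
Proof.
  induction G as [|a G IH]; intros H.
  - exists nil. split; [intros q []|apply incl_nil_l].
  - destruct IH as (G' & HT & HG); [intros; apply H; now right|].
    destruct (H a (or_introl eq_refl)) as [Ha| ->].
    + exists (a :: G'). split; [intros q [<-|]; auto|].
      intros x [<-|Hx]; [right; now left|].
      destruct (HG x Hx) as [->|]; [now left|right; now right].
    + exists G'. split; [exact HT|]. intros x [<-|Hx]; [now left|auto].
Qed.

Lemma provable_impI T p q : provable (add T p) q -> provable T (Imp p q).
Proof.
  intros (G & HG & H). apply add_assumptions in HG as (G' & HT & Hincl).
  exists G'. split; [exact HT|]. apply prf_impI. now apply prf_weaken with G.
Qed.

Lemma provable_raa T p : ~ consistent (add T (Neg p)) -> provable T p.
Proof.
  intros H. apply NNPP, provable_impI in H. revert H. apply provable_prf1.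
  intros G H. apply prf_raa. apply prf_impE with (Neg p).
  - apply prf_weaken with G; [exact H|]. intros x Hx. now right.
  - apply prf_ax. now left.
Qed.

(** * The Henkin extension *)

Fixpoint code (p : form) : nat :=
  match p with
  | Bot => to_nat (0, 0)
  | Eq i j => to_nat (1, to_nat (i, j))
  | Mem i j => to_nat (2, to_nat (i, j))
  | Imp p q => to_nat (3, to_nat (code p, code q))
  | All p => to_nat (4, code p)
  end.

Lemma code_inj p : forall q, code p = code q -> p = q.
Proof.
  induction p as [|i j|i j|p IHp q IHq|p IHp]; intros [|i' j'|i' j'|p' q'|p'] E;
    cbn [code] in E; apply to_nat_inj in E; try discriminate;
    try reflexivity; apply pair_equal_spec in E as [_ E];
    try (apply to_nat_inj, pair_equal_spec in E as [E1 E2]); f_equal; auto.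
Qed.

(** Every formula is some [decode n], so the stages consider all of them. *)
Definition decode (n : nat) : form := epsilon (inhabits Bot) (fun p => code p = n).

Lemma decode_code p : decode (code p) = p.
Proof.
  apply code_inj. unfold decode. apply (epsilon_spec (inhabits Bot)
    (fun q => code q = code p)). now exists p.
Qed.

(** A stage carries a bound on the free variables of its formulas, so that
    fresh ones can be named. *)
Definition stage : Type := ((form -> Prop) * nat)%type.

Definition add_stage (G : stage) (p : form) : stage :=
  (add (fst G) p, Nat.max (snd G) (bound p)).

(** A formula [All q] that cannot be added consistently is refuted by [G], so a
    fresh variable can be made a counterexample to it. *)
Definition extend (G : stage) (p : form) : stage :=
  if excluded_middle_informative (consistent (add (fst G) p)) then add_stage G p
  else match p with
       | All q => add_stage G (Neg (inst (Nat.max (snd G) (bound p)) q))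
       | _ => G
       end.

Fixpoint henkin_stage (T : form -> Prop) (n : nat) : stage :=
  match n with
  | 0 => (T, 0)
  | S n => extend (henkin_stage T n) (decode n)
  end.

Definition henkin (T : form -> Prop) (p : form) : Prop :=
  exists n, fst (henkin_stage T n) p.

Lemma extend_incl G p q : fst G q -> fst (extend G p) q.
Proof.
  intros H. unfold extend, add_stage, add.
  destruct excluded_middle_informative; [simpl; auto|destruct p; simpl; auto].
Qed.

Lemma extend_bound G p : (forall q, fst G q -> bound q <= snd G) ->
  forall q, fst (extend G p) q -> bound q <= snd (extend G p).
Proof.
  intros H. assert (A : forall r q, fst (add_stage G r) q ->
    bound q <= snd (add_stage G r)).
  { intros r q [Hq| ->]; [apply H in Hq|]; simpl; lia. }
  unfold extend. destruct excluded_middle_informative; [apply A|].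
  destruct p; auto.
Qed.

(** In the case of a counterexample [k] to a refuted [All q]: if adding
    [Neg (inst k q)] were inconsistent, [inst k q] would be derivable, hence
    [All q] as well because [k] is fresh. *)
Lemma extend_consistent G p : (forall q, fst G q -> bound q <= snd G) ->
  consistent (fst G) -> consistent (fst (extend G p)).
Proof.
  intros HB HC. unfold extend. destruct excluded_middle_informative as [|Hp];
    [assumption|]. destruct p as [| | | |q]; try assumption.
  intros H. apply Hp. clear Hp. intros Hp. apply provable_impI in Hp.
  apply HC. apply provable_impE with (All q); [exact Hp|].
  assert (Hk : provable (fst G) (inst (Nat.max (snd G) (bound (All q))) q)).
  { apply provable_raa. intros C. now apply C. }
  destruct Hk as (L & HL & Hk). exists L. split; [exact HL|].
  apply prf_fresh_allI in Hk; [exact Hk| |lia].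
  intros r Hr. apply HL, HB in Hr. lia.
Qed.

Section Henkin.

Context (T : form -> Prop).
Context (T_closed : forall p, T p -> bound p = 0) (T_consistent : consistent T).

Lemma henkin_stage_mono m n p : m <= n ->
  fst (henkin_stage T m) p -> fst (henkin_stage T n) p.
Proof. induction 1; [auto|]. intros H'. simpl. auto using extend_incl. Qed.

Lemma henkin_stage_invariant n :
  (forall q, fst (henkin_stage T n) q -> bound q <= snd (henkin_stage T n)) /\
  consistent (fst (henkin_stage T n)).
Proof.
  induction n as [|n [IHb IHc]]; simpl.
  - split; [|exact T_consistent]. intros q Hq. now rewrite T_closed.
  - split; [now apply extend_bound|now apply extend_consistent].
Qed.

Lemma henkin_incl p : T p -> henkin T p.
Proof. now exists 0. Qed.

Lemma henkin_consistent : consistent (henkin T).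
Proof.
  intros (L & HL & H).
  enough (exists n, forall q, In q L -> fst (henkin_stage T n) q) as (n & Hn).
  { apply (proj2 (henkin_stage_invariant n)). now exists L. }
  clear H. induction L as [|a L IH]; [exists 0; intros q []|].
  destruct IH as (n & Hn); [intros; apply HL; now right|].
  destruct (HL a (or_introl eq_refl)) as (m & Hm).
  exists (Nat.max m n). intros q [<-|Hq].
  - now apply henkin_stage_mono with m; [lia|].
  - apply henkin_stage_mono with n; [lia|auto].
Qed.

Lemma henkin_maximal p : consistent (add (henkin T) p) -> henkin T p.
Proof.
  intros H. exists (S (code p)). simpl. rewrite decode_code. unfold extend.
  destruct excluded_middle_informative as [|C]; [now right|].
  exfalso. apply C. intros D. apply H. revert D. apply provable_mono.
  intros q [Hq| ->]; [left; now exists (code p)|now right].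
Qed.

Lemma henkin_closed p : provable (henkin T) p -> henkin T p.
Proof.
  intros H. apply henkin_maximal. intros C. apply henkin_consistent.
  apply provable_impE with p; [now apply provable_impI|exact H].
Qed.

Lemma henkin_Imp p q : henkin T (Imp p q) <-> (henkin T p -> henkin T q).
Proof.
  split.
  - intros H Hp. apply henkin_closed.
    apply provable_impE with p; now apply provable_ax.
  - intros H. apply henkin_closed. destruct (classic (henkin T p)) as [Hp|Hp].
    + apply H, provable_ax in Hp. revert Hp. apply provable_prf1.
      intros G Hq. apply prf_impI. apply prf_weaken with G; [exact Hq|].
      intros x Hx. now right.
    + apply provable_impI. apply NNPP. intros C. apply Hp, henkin_maximal.
      intros D. apply C. revert D. apply provable_prf1. intros G D.
      apply prf_raa. apply prf_weaken with G; [exact D|]. intros x Hx. now right.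
Qed.

Lemma henkin_Bot : ~ henkin T Bot.
Proof. intros H. now apply henkin_consistent, provable_ax. Qed.

Lemma henkin_All p : henkin T (All p) <-> forall t, henkin T (inst t p).
Proof.
  split.
  - intros H t. apply henkin_closed. apply provable_ax in H. revert H.
    apply provable_prf1. intros G. apply prf_allE.
  - intros H. apply NNPP. intros C.
    set (n := code (All p)). set (k := Nat.max (snd (henkin_stage T n)) (bound (All p))).
    assert (Hk : henkin T (Neg (inst k p))).
    { exists (S n). simpl. unfold n at 2. rewrite decode_code. unfold extend.
      destruct excluded_middle_informative as [D|]; [|now right].
      exfalso. apply C. exists (S n). simpl. unfold n at 2. rewrite decode_code.
      unfold extend. destruct excluded_middle_informative; [now right|tauto]. }
    apply henkin_Bot. apply (proj1 (henkin_Imp _ _) Hk), H.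
Qed.

Lemma henkin_eq_refl i : henkin T (Eq i i).
Proof.
  apply henkin_closed. exists nil. split; [intros q []|apply prf_eqI].
Qed.

Lemma henkin_eq_subst i j p :
  henkin T (Eq i j) -> henkin T (inst i p) -> henkin T (inst j p).
Proof.
  intros H1 H2. apply henkin_closed.
  apply provable_prf2 with (Eq i j) (inst i p); try now apply provable_ax.
  intros G. apply prf_eqE.
Qed.

Lemma henkin_eq_sym i j : henkin T (Eq i j) -> henkin T (Eq j i).
Proof.
  intros H. apply (henkin_eq_subst i j (Eq 0 (S i)) H), henkin_eq_refl.
Qed.

Lemma henkin_eq_trans i j k :
  henkin T (Eq i j) -> henkin T (Eq j k) -> henkin T (Eq i k).
Proof. intros H1 H2. exact (henkin_eq_subst j k (Eq (S i) 0) H2 H1). Qed.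

End Henkin.

(** * Models *)

Fixpoint sat {M : Type} (mem : M -> M -> Prop) (rho : nat -> M) (p : form) : Prop :=
  match p with
  | Bot => False
  | Eq i j => rho i = rho j
  | Mem i j => mem (rho i) (rho j)
  | Imp p q => sat mem rho p -> sat mem rho q
  | All p => forall x, sat mem (scons x rho) p
  end.

Lemma sat_agree {M} (mem : M -> M -> Prop) p : forall rho sigma,
  (forall i, i < bound p -> rho i = sigma i) -> sat mem rho p <-> sat mem sigma p.
Proof.
  induction p as [|i j|i j|p IHp q IHq|p IHp]; intros r s E; simpl in *.
  - tauto.
  - rewrite (E i), (E j) by lia. tauto.
  - rewrite (E i), (E j) by lia. tauto.
  - rewrite (IHp r s), (IHq r s) by (intros; apply E; lia). tauto.
  - enough (forall x, sat mem (scons x r) p <-> sat mem (scons x s) p) by firstorder.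
    intros x. apply IHp. intros [|i] Hi; simpl; [reflexivity|]. apply E. lia.
Qed.

Lemma sat_rename {M} (mem : M -> M -> Prop) p : forall rho r,
  sat mem rho (rename r p) <-> sat mem (fun i => rho (r i)) p.
Proof.
  induction p as [|i j|i j|p IHp q IHq|p IHp]; intros rho r; simpl; try tauto.
  - rewrite IHp, IHq. tauto.
  - enough (forall x, sat mem (scons x rho) (rename (up r) p) <->
      sat mem (scons x (fun i => rho (r i))) p) by firstorder.
    intros x. rewrite IHp. apply sat_agree. now intros [|i].
Qed.

Section TermModel.

Context (T : form -> Prop).
Context (T_closed : forall p, T p -> bound p = 0) (T_consistent : consistent T).

(** The classes of the variables modulo equality in [henkin T], encoded as
    predicates so that equal classes are equal elements. *)
Definition term_model : Type :=
  {c : nat -> Prop | exists i, c = fun j => henkin T (Eq i j)}.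

Definition class (i : nat) : term_model :=
  exist _ (fun j => henkin T (Eq i j)) (ex_intro _ i eq_refl).

Definition term_mem (x y : term_model) : Prop :=
  exists i j, x = class i /\ y = class j /\ henkin T (Mem i j).

Lemma class_surjective x : exists i, x = class i.
Proof.
  destruct x as [c [i Hi]]. exists i. now apply subset_eq_compat.
Qed.

Lemma class_eq i j : class i = class j <-> henkin T (Eq i j).
Proof.
  split.
  - intros E. apply (f_equal (@proj1_sig _ _)) in E. simpl in E.
    apply (f_equal (fun c => c j)) in E. rewrite E. now apply henkin_eq_refl.
  - intros H. apply subset_eq_compat. extensionality k.
    apply propositional_extensionality. split; intros H'.
    + apply henkin_eq_trans with i; auto using henkin_eq_sym.
    + apply henkin_eq_trans with j; auto.
Qed.

Lemma class_mem i j : term_mem (class i) (class j) <-> henkin T (Mem i j).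
Proof.
  split.
  - intros (i' & j' & Hi & Hj & H). apply class_eq in Hi, Hj.
    apply henkin_eq_sym in Hi, Hj; trivial.
    apply (henkin_eq_subst T T_closed T_consistent i' i (Mem 0 (S j)) Hi).
    exact (henkin_eq_subst T T_closed T_consistent j' j (Mem (S i') 0) Hj H).
  - intros H. now exists i, j.
Qed.

(** The renaming [s] chooses variables that represent the values of an
    environment; without it the statement would not pass under a quantifier. *)
Lemma truth_lemma p : forall s,
  sat term_mem (fun i => class (s i)) p <-> henkin T (rename s p).
Proof.
  induction p as [|i j|i j|p IHp q IHq|p IHp]; intros s; simpl.
  - split; [tauto|now apply henkin_Bot].
  - apply class_eq.
  - apply class_mem.
  - rewrite henkin_Imp, IHp, IHq by trivial. tauto.
  - rewrite henkin_All by trivial.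
    assert (E : forall t, sat term_mem (scons (class t) (fun i => class (s i))) p <->
      henkin T (inst t (rename (up s) p))).
    { intros t. rewrite inst_up, <- IHp. apply sat_agree. now intros [|i]. }
    split.
    + intros H t. apply E, H.
    + intros H x. destruct (class_surjective x) as [t ->]. apply E, H.
Qed.

End TermModel.

(** If [p] were not derivable, [Neg p] would be consistent with [T], and the
    term model of [add T (Neg p)] would satisfy [T] but not [p]. *)
Theorem completeness (T : form -> Prop) (p : form) :
  (forall q, T q -> bound q = 0) -> bound p = 0 ->
  (forall (M : Type) (mem : M -> M -> Prop) (rho : nat -> M),
     (forall q, T q -> sat mem rho q) -> sat mem rho p) ->
  provable T p.
Proof.
  intros HT Hp H. apply provable_raa. intros C.
  assert (HT' : forall q, add T (Neg p) q -> bound q = 0).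
  { intros q [Hq| ->]; [now apply HT|]. simpl. now rewrite Hp. }
  assert (truth : forall q, bound q = 0 ->
    sat (term_mem (add T (Neg p))) (class (add T (Neg p))) q <->
    henkin (add T (Neg p)) q).
  { intros q Hq. rewrite <- (rename_closed (fun i => i) q Hq) at 2.
    now apply (truth_lemma (add T (Neg p)) HT' C q (fun i => i)). }
  apply (henkin_Bot _ HT' C).
  apply (proj1 (henkin_Imp _ HT' C p Bot)).
  - apply henkin_incl. now right.
  - apply truth; [exact Hp|]. apply H. intros q Hq. apply truth; [now apply HT|].
    apply henkin_incl. now left.
Qed.

(** * Set-theoretic notions in a structure *)

Declare Scope set_scope.
Local Open Scope set_scope.

Section Notions.

Context {M : Type} (mem : M -> M -> Prop).

Local Notation "x ∈ y" := (mem x y) (at level 70) : set_scope.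

Definition Subset (a b : M) := forall x, x ∈ a -> x ∈ b.
Definition ProperSubset (a b : M) := Subset a b /\ ~ a = b.
Definition IsEmpty (e : M) := forall x, ~ x ∈ e.
Definition IsPair (c a b : M) := forall x, x ∈ c <-> (x = a \/ x = b).
Definition IsUnion (u a : M) := forall x, x ∈ u <-> exists y, y ∈ a /\ x ∈ y.
Definition IsPower (p a : M) := forall x, x ∈ p <-> Subset x a.
Definition IsSucc (s a : M) := forall x, x ∈ s <-> (x ∈ a \/ x = a).
Definition IsInductive (i : M) :=
  (exists e, IsEmpty e /\ e ∈ i) /\
  (forall a, a ∈ i -> exists s, IsSucc s a /\ s ∈ i).
Definition IsOmega (w : M) :=
  IsInductive w /\ forall i, IsInductive i -> Subset w i.
Definition IsOPair (p x y : M) :=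
  exists s t, IsPair s x x /\ IsPair t x y /\ IsPair p s t.
Definition Related (r x y : M) := exists p, IsOPair p x y /\ p ∈ r.
Definition IsRelation (r a b : M) :=
  forall p, p ∈ r -> exists x y, x ∈ a /\ y ∈ b /\ IsOPair p x y.
Definition IsFunction (f a b : M) :=
  IsRelation f a b /\
  (forall x, x ∈ a -> exists y, Related f x y) /\
  (forall x y z, Related f x y -> Related f x z -> y = z).
Definition IsInjection (f a b : M) :=
  IsFunction f a b /\
  (forall x y z, Related f x z -> Related f y z -> x = y).
Definition IsBijection (f a b : M) :=
  IsInjection f a b /\ (forall y, y ∈ b -> exists x, Related f x y).
Definition Equipotent (a b : M) := exists f, IsBijection f a b.
Definition Finite (X : M) :=
  exists w, IsOmega w /\ exists n, n ∈ w /\ Equipotent X n.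
Definition Countable (X : M) := exists w, IsOmega w /\ Equipotent X w.
Definition StandardInfinite (X : M) := ~ Finite X.
Definition CardinalInfinite (X : M) :=
  exists w, IsOmega w /\ exists f, IsInjection f w X.
Definition CantorInfinite (X : M) := exists B, Subset B X /\ Countable B.
Definition DedekindInfinite (X : M) :=
  exists B, ProperSubset B X /\ Equipotent B X.

End Notions.

Ltac unfold_notions := unfold StandardInfinite, CardinalInfinite, CantorInfinite,
  DedekindInfinite, Countable, Finite, Equipotent, IsBijection, IsInjection,
  IsFunction, IsRelation, Related, IsOPair, IsOmega, IsInductive, IsSucc,
  IsPower, IsUnion, IsPair, IsEmpty, ProperSubset, Subset.

Section Reflection.

Context {M : Type} (mem : M -> M -> Prop) (rho : nat -> M).

Lemma sat_All p (Q : M -> Prop) : (forall m, sat mem (scons m rho) p <-> Q m) ->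
  sat mem rho (All p) <-> forall m, Q m.
Proof. simpl. firstorder. Qed.

Lemma sat_Ex p (Q : M -> Prop) : (forall m, sat mem (scons m rho) p <-> Q m) ->
  sat mem rho (Ex p) <-> exists m, Q m.
Proof.
  intros H. simpl. split.
  - intros C. apply NNPP. intros D. apply C. intros m Hm. apply D. exists m.
    now apply H.
  - intros [m Hm] C. apply (C m). now apply H.
Qed.

Lemma sat_Imp p q P Q : (sat mem rho p <-> P) -> (sat mem rho q <-> Q) ->
  sat mem rho (Imp p q) <-> (P -> Q).
Proof. simpl. tauto. Qed.

Lemma sat_Neg p P : (sat mem rho p <-> P) -> sat mem rho (Neg p) <-> ~ P.
Proof. simpl. tauto. Qed.

Lemma sat_And p q P Q : (sat mem rho p <-> P) -> (sat mem rho q <-> Q) ->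
  sat mem rho (And p q) <-> P /\ Q.
Proof. simpl. tauto. Qed.

Lemma sat_Or p q P Q : (sat mem rho p <-> P) -> (sat mem rho q <-> Q) ->
  sat mem rho (Or p q) <-> P \/ Q.
Proof. simpl. tauto. Qed.

Lemma sat_Iff p q P Q : (sat mem rho p <-> P) -> (sat mem rho q <-> Q) ->
  sat mem rho (Iff p q) <-> (P <-> Q).
Proof. simpl. tauto. Qed.

End Reflection.

Ltac unfold_forms := cbv beta delta
  [standard_infinite cardinal_infinite cantor_infinite dedekind_infinite
   countable finite equipotent is_bijection is_injection is_function is_relation
   related is_opair is_omega inductive is_succ is_power is_union is_pair is_empty
   proper_subset subset sentence pall pex pand por pimp piff pneg pmem peq].

(** Proves that a concrete formula holds in an environment if and only if its
    counterpart in the metalanguage does. *)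
Ltac reflect := unfold_forms; unfold_notions;
  repeat lazymatch goal with
  | |- sat _ _ (All _) <-> _ => apply sat_All; intro
  | |- sat _ _ (Ex _) <-> _ => apply sat_Ex; intro
  | |- sat _ _ (And _ _) <-> _ => apply sat_And
  | |- sat _ _ (Or _ _) <-> _ => apply sat_Or
  | |- sat _ _ (Iff _ _) <-> _ => apply sat_Iff
  | |- sat _ _ (Neg _) <-> _ => apply sat_Neg
  | |- sat _ _ (Imp _ _) <-> _ => apply sat_Imp
  | |- sat _ _ (Eq _ _) <-> _ => apply iff_refl
  | |- sat _ _ (Mem _ _) <-> _ => apply iff_refl
  end.

(** * Definability with parameters *)

(** The entries below [n] are arguments, those from [n] on are parameters. *)
Definition append {A : Type} (n : nat) (r ps : nat -> A) (i : nat) : A :=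
  if i <? n then r i else ps (i - n).

(** Two sequences of parameters are interleaved, so that formulas with
    different parameters can be combined into one. *)
Lemma append_merge {A : Type} n (ps qs : nat -> A) :
  exists us f g, forall r i,
    append n r us (f i) = append n r ps i /\ append n r us (g i) = append n r qs i.
Proof.
  exists (fun j => if Nat.even j then ps (Nat.div2 j) else qs (Nat.div2 j)).
  exists (fun i => if i <? n then i else n + 2 * (i - n)).
  exists (fun i => if i <? n then i else n + S (2 * (i - n))).
  intros r i. unfold append. destruct (Nat.ltb_spec i n) as [H|H].
  - apply Nat.ltb_lt in H. now rewrite H.
  - split.
    + destruct (Nat.ltb_spec (n + 2 * (i - n)) n); [lia|].
      replace (n + 2 * (i - n) - n) with (2 * (i - n)) by lia.
      now rewrite Nat.even_even, Nat.div2_double.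
    + destruct (Nat.ltb_spec (n + S (2 * (i - n))) n); [lia|].
      replace (n + S (2 * (i - n)) - n) with (S (2 * (i - n))) by lia.
      rewrite Nat.div2_succ_double, Nat.even_succ, Nat.odd_mul. reflexivity.
Qed.


Section Model.

Context {M : Type} (mem : M -> M -> Prop) (rho : nat -> M).

Local Notation "x ∈ y" := (mem x y) (at level 70) : set_scope.
Local Notation Subset := (Subset mem).
Local Notation IsEmpty := (IsEmpty mem).
Local Notation IsPair := (IsPair mem).
Local Notation IsUnion := (IsUnion mem).
Local Notation IsPower := (IsPower mem).
Local Notation IsSucc := (IsSucc mem).
Local Notation IsInductive := (IsInductive mem).
Local Notation IsOmega := (IsOmega mem).
Local Notation IsOPair := (IsOPair mem).
Local Notation Related := (Related mem).
Local Notation IsRelation := (IsRelation mem).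
Local Notation IsFunction := (IsFunction mem).
Local Notation IsInjection := (IsInjection mem).
Local Notation IsBijection := (IsBijection mem).
Local Notation Equipotent := (Equipotent mem).

Definition definable (n : nat) (P : (nat -> M) -> Prop) : Prop :=
  exists p ps, forall r, sat mem (append n r ps) p <-> P r.

(** The denotations of variables, be they arguments or parameters. *)
Definition term (n : nat) (t : (nat -> M) -> M) : Prop :=
  exists i ps, forall r, append n r ps i = t r.

Lemma term_var n i : i < n -> term n (fun r => r i).
Proof.
  intros H. exists i, rho. intros r. apply Nat.ltb_lt in H.
  unfold append. now rewrite H.
Qed.

Lemma term_const n c : term n (fun _ => c).
Proof.
  exists n, (fun _ => c). intros r. unfold append. now rewrite Nat.ltb_irrefl.
Qed.

Lemma definable_mem n t u : term n t -> term n u ->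
  definable n (fun r => t r ∈ u r).
Proof.
  intros (i & ps & Ht) (j & qs & Hu).
  destruct (append_merge n ps qs) as (us & f & g & E).
  exists (Mem (f i) (g j)), us. intros r. simpl.
  rewrite (proj1 (E r i)), (proj2 (E r j)), Ht, Hu. reflexivity.
Qed.

Lemma definable_eq n t u : term n t -> term n u ->
  definable n (fun r => t r = u r).
Proof.
  intros (i & ps & Ht) (j & qs & Hu).
  destruct (append_merge n ps qs) as (us & f & g & E).
  exists (Eq (f i) (g j)), us. intros r. simpl.
  rewrite (proj1 (E r i)), (proj2 (E r j)), Ht, Hu. reflexivity.
Qed.

Lemma definable_False n : definable n (fun _ => False).
Proof. exists Bot, rho. intros r. reflexivity. Qed.

Lemma definable_impl n P Q : definable n P -> definable n Q ->
  definable n (fun r => P r -> Q r).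
Proof.
  intros (p & ps & Hp) (q & qs & Hq).
  destruct (append_merge n ps qs) as (us & f & g & E).
  exists (Imp (rename f p) (rename g q)), us. intros r. simpl.
  rewrite !sat_rename, <- Hp, <- Hq.
  rewrite (sat_agree mem p _ (append n r ps)) by (intros; apply E).
  rewrite (sat_agree mem q _ (append n r qs)) by (intros; apply E).
  reflexivity.
Qed.

Lemma definable_all n (Q : (nat -> M) -> M -> Prop) :
  definable (S n) (fun r => Q (fun i => r (S i)) (r 0)) ->
  definable n (fun r => forall m, Q r m).
Proof.
  intros (q & ps & Hq). exists (All q), ps. intros r. apply sat_All. intros m.
  rewrite <- (Hq (scons m r)). apply sat_agree. now intros [|i].
Qed.

Lemma definable_iff n P Q : (forall r, P r <-> Q r) -> definable n P -> definable n Q.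
Proof.
  intros E (p & ps & Hp). exists p, ps. intros r. rewrite Hp. apply E.
Qed.

Lemma definable_and n P Q : definable n P -> definable n Q ->
  definable n (fun r => P r /\ Q r).
Proof.
  intros HP HQ.
  apply definable_iff with (fun r => (P r -> Q r -> False) -> False).
  - intros r. tauto.
  - repeat apply definable_impl; auto using definable_False.
Qed.

Lemma definable_or n P Q : definable n P -> definable n Q ->
  definable n (fun r => P r \/ Q r).
Proof.
  intros HP HQ. apply definable_iff with (fun r => (P r -> False) -> Q r).
  - intros r. tauto.
  - repeat apply definable_impl; auto using definable_False.
Qed.

Lemma definable_ex n (Q : (nat -> M) -> M -> Prop) :
  definable (S n) (fun r => Q (fun i => r (S i)) (r 0)) ->
  definable n (fun r => exists m, Q r m).
Proof.
  intros HQ.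
  apply definable_iff with (fun r => (forall m, Q r m -> False) -> False).
  - intros r. split; [|firstorder]. intros C. apply NNPP. firstorder.
  - apply definable_impl; [|apply definable_False].
    apply (definable_all n (fun r m => Q r m -> False)).
    apply definable_impl; [exact HQ|apply definable_False].
Qed.

Lemma definable_reindex m n (f : nat -> nat) P : (forall i, i < m -> f i < n) ->
  definable m P -> definable n (fun r => P (fun i => r (f i))).
Proof.
  intros Hf (p & ps & Hp).
  exists (rename (fun i => if i <? m then f i else n + (i - m)) p), ps.
  intros r. rewrite sat_rename, <- Hp. apply sat_agree. intros i _.
  unfold append. destruct (Nat.ltb_spec i m) as [H|H].
  - apply Hf, Nat.ltb_lt in H. now rewrite H.
  - destruct (Nat.ltb_spec (n + (i - m)) n); [lia|]. f_equal. lia.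
Qed.

(** For a relation [R] known only to be definable, the arguments at which it
    occurs are read off from a larger environment. *)
Lemma definable2_var n (R : M -> M -> Prop) i j : i < n -> j < n ->
  definable 2 (fun r => R (r 0) (r 1)) -> definable n (fun r => R (r i) (r j)).
Proof.
  intros Hi Hj. apply (definable_reindex 2 n (fun k => nth k (i :: j :: nil) 0)).
  intros [|[|k]] Hk; simpl; lia.
Qed.

Lemma definable3_var n (R : M -> M -> M -> Prop) i j k : i < n -> j < n -> k < n ->
  definable 3 (fun r => R (r 0) (r 1) (r 2)) ->
  definable n (fun r => R (r i) (r j) (r k)).
Proof.
  intros Hi Hj Hk.
  apply (definable_reindex 3 n (fun l => nth l (i :: j :: k :: nil) 0)).
  intros [|[|[|l]]] Hl; simpl; lia.
Qed.

Ltac term := first [apply term_var; lia | apply term_const].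

Ltac definable := unfold_notions; unfold iff, not;
  repeat (cbv beta; first
    [ assumption
    | apply definable_False
    | apply definable_mem; term
    | apply definable_eq; term
    | apply definable_and
    | apply definable_or
    | apply definable_impl
    | apply definable_ex
    | apply definable_all
    | apply definable2_var; [lia|lia|assumption]
    | apply definable3_var; [lia|lia|lia|assumption] ]).

(** * Consequences of the axioms *)

Context (axioms : forall q, Z_ACω q -> sat mem rho q).

Lemma axiom_holds q P : Z_ACω q -> (sat mem rho q <-> P) -> P.
Proof. intros H E. now apply E, axioms. Qed.

Lemma extensionality a b : (forall x, x ∈ a <-> x ∈ b) -> a = b.
Proof.
  revert a b. apply (axiom_holds ax_extensionality); [left; constructor|].
  unfold ax_extensionality. reflect.
Qed.

Lemma empty_set : exists e, IsEmpty e.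
Proof.
  apply (axiom_holds ax_null); [left; constructor|]. unfold ax_null. reflect.
Qed.

Lemma pair_set a b : exists c, IsPair c a b.
Proof.
  revert a b. apply (axiom_holds ax_pair); [left; constructor|].
  unfold ax_pair. reflect.
Qed.

Lemma union_set a : exists u, IsUnion u a.
Proof.
  revert a. apply (axiom_holds ax_union); [left; constructor|].
  unfold ax_union. reflect.
Qed.

Lemma inductive_set : exists i, IsInductive i.
Proof.
  apply (axiom_holds ax_infinity); [left; constructor|].
  unfold ax_infinity. reflect.
Qed.

Lemma power_set a : exists p, IsPower p a.
Proof.
  revert a. apply (axiom_holds ax_power); [left; constructor|].
  unfold ax_power. reflect.
Qed.

Lemma countable_choice w b P : IsOmega w -> IsRelation P w b ->
  (forall n, n ∈ w -> exists y, y ∈ b /\ Related P n y) ->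
  exists f, IsFunction f w b /\
    forall n, n ∈ w -> exists y, Related f n y /\ Related P n y.
Proof.
  intros Hw. revert b P. revert w Hw.
  apply (axiom_holds ax_countable_choice); [now right|].
  unfold ax_countable_choice. reflect.
Qed.

Lemma sat_iter_All n p : forall r, sat mem r (Nat.iter n All p) ->
  forall s, (forall i, s (n + i) = r i) -> sat mem s p.
Proof.
  induction n as [|n IH]; simpl; intros r H s E.
  - revert H. apply sat_agree. auto.
  - apply IH with (scons (s n) r); [apply H|]. intros [|i]; simpl.
    + f_equal. lia.
    + rewrite <- E. f_equal. lia.
Qed.

(** Only the values of [s] below [bound p] matter; from there on the
    environment can continue as [r]. *)
Lemma sat_closure r s p : sat mem r (closure p) -> sat mem s p.
Proof.
  intros H. apply sat_agree with (append (bound p) s r).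
  - intros i Hi. unfold append. apply Nat.ltb_lt in Hi. now rewrite Hi.
  - apply (sat_iter_All _ _ _ H). intros i. unfold append.
    destruct (Nat.ltb_spec (bound p + i) (bound p)); [lia|]. f_equal. lia.
Qed.

Lemma separation (P : M -> Prop) a : definable 1 (fun r => P (r 0)) ->
  exists y, forall x, x ∈ y <-> x ∈ a /\ P x.
Proof.
  intros (p & ps & Hp). revert a.
  assert (H : sat mem rho (ax_comprehension p)) by (apply axioms; left; constructor).
  unfold ax_comprehension in H. apply sat_closure with (s := ps) in H.
  match type of H with ?A => enough (E : A <-> forall a, exists y, forall x,
    x ∈ y <-> x ∈ a /\ P x) by exact (proj1 E H) end.
  reflect.
  rewrite sat_rename, <- (Hp (fun _ => m1)). apply sat_agree.
  intros [|i] _; cbn; [reflexivity|]. now rewrite Nat.sub_0_r.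
Qed.

(** * Pairs, relations and functions *)

Lemma succ_set a : exists s, IsSucc s a.
Proof.
  destruct (pair_set a a) as [b Hb]. destruct (pair_set a b) as [c Hc].
  destruct (union_set c) as [s Hs]. exists s. intros x. rewrite (Hs x). split.
  - intros (y & Hy & Hx). apply Hc in Hy as [ -> | ->]; [now left|].
    right. apply Hb in Hx. tauto.
  - intros [Hx | ->].
    + exists a. split; [|assumption]. apply Hc. now left.
    + exists b. split; [apply Hc; now right|]. apply Hb. now left.
Qed.

Lemma succ_unique s s' a : IsSucc s a -> IsSucc s' a -> s = s'.
Proof.
  intros H H'. apply extensionality. intros x. now rewrite (H x), (H' x).
Qed.

Lemma opair_exists x y : exists p, IsOPair p x y.
Proof.
  destruct (pair_set x x) as [s Hs]. destruct (pair_set x y) as [t Ht].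
  destruct (pair_set s t) as [p Hp]. now exists p, s, t.
Qed.

Lemma pair_unique c c' a b : IsPair c a b -> IsPair c' a b -> c = c'.
Proof.
  intros H H'. apply extensionality. intros x. now rewrite (H x), (H' x).
Qed.

Lemma opair_unique p p' x y : IsOPair p x y -> IsOPair p' x y -> p = p'.
Proof.
  intros (s & t & Hs & Ht & Hp) (s' & t' & Hs' & Ht' & Hp').
  rewrite (pair_unique s' s x x), (pair_unique t' t x y) in Hp' by assumption.
  now apply (pair_unique p p' s t).
Qed.

Lemma pair_inj c a b b' : IsPair c a b -> IsPair c a b' -> b = b'.
Proof.
  intros H H'.
  destruct (proj1 (H' b) (proj2 (H b) (or_intror eq_refl))) as [ ->|]; [|assumption].
  destruct (proj1 (H b') (proj2 (H' b') (or_intror eq_refl))); congruence.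
Qed.

Lemma opair_inj p x y x' y' : IsOPair p x y -> IsOPair p x' y' -> x = x' /\ y = y'.
Proof.
  intros (s & t & Hs & Ht & Hp) (s' & t' & Hs' & Ht' & Hp').
  assert (Ex : x = x').
  { assert (Hx : x' ∈ s).
    { destruct (proj1 (Hp' s) (proj2 (Hp s) (or_introl eq_refl))) as [ -> | ->].
      - apply Hs'. now left.
      - apply Ht'. now left. }
    apply Hs in Hx. intuition congruence. }
  subst x'. split; [reflexivity|].
  rewrite (pair_unique s' s x x) in Hp' by assumption.
  rewrite (pair_inj p s t' t) in Ht' by assumption.
  now apply (pair_inj t x).
Qed.

Lemma relation_dom r a b x y : IsRelation r a b -> Related r x y -> x ∈ a /\ y ∈ b.
Proof.
  intros Hr (p & Hp & Hpr). destruct (Hr p Hpr) as (x' & y' & Hx & Hy & Hp').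
  destruct (opair_inj p x y x' y'); now subst.
Qed.

(** Pairs of elements of [a] and [b] are found in the double power set of a
    set that includes both. *)
Lemma relation_comprehension (R : M -> M -> Prop) a b :
  definable 2 (fun r => R (r 0) (r 1)) ->
  exists r, IsRelation r a b /\
    forall x y, Related r x y <-> x ∈ a /\ y ∈ b /\ R x y.
Proof.
  intros HR. destruct (pair_set a b) as [c Hc]. destruct (union_set c) as [u Hu].
  destruct (power_set u) as [v Hv]. destruct (power_set v) as [z Hz].
  destruct (separation (fun p => exists x y, x ∈ a /\ y ∈ b /\ IsOPair p x y /\ R x y) z)
    as [r Hr]; [definable|].
  exists r. split.
  - intros p Hp. apply Hr in Hp as (_ & x & y & Hx & Hy & Hp & _). eauto.
  - intros x y. split.
    + intros (p & Hp & Hpr). apply Hr in Hpr as (_ & x' & y' & H).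
      destruct (opair_inj p x y x' y'); [tauto..|]. subst. tauto.
    + intros (Hx & Hy & HRxy). destruct (opair_exists x y) as [p Hp].
      exists p. split; [assumption|]. apply Hr. split; [|now exists x, y].
      assert (Hxu : x ∈ u) by (apply Hu; exists a; split; [apply Hc; now left|assumption]).
      assert (Hyu : y ∈ u) by (apply Hu; exists b; split; [apply Hc; now right|assumption]).
      destruct Hp as (s & t & Hs & Ht & Hp).
      apply Hz. intros k Hk. apply Hv. intros l Hl.
      apply Hp in Hk as [ -> | ->]; [apply Hs in Hl as [ -> | ->]|apply Ht in Hl as [ -> | ->]];
        assumption.
Qed.

Lemma injection_comprehension (R : M -> M -> Prop) a b :
  definable 2 (fun r => R (r 0) (r 1)) ->
  (forall x, x ∈ a -> exists y, y ∈ b /\ R x y) ->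
  (forall x y z, x ∈ a -> y ∈ b -> z ∈ b -> R x y -> R x z -> y = z) ->
  (forall x y z, x ∈ a -> y ∈ a -> z ∈ b -> R x z -> R y z -> x = y) ->
  exists f, IsInjection f a b /\
    forall x y, Related f x y <-> x ∈ a /\ y ∈ b /\ R x y.
Proof.
  intros HR Htot Hfun Hinj. destruct (relation_comprehension R a b HR) as (f & Hf & Hrel).
  exists f. split; [|exact Hrel]. repeat split; trivial.
  - intros x Hx. destruct (Htot x Hx) as (y & Hy & Hxy). exists y. now apply Hrel.
  - intros x y z H1 H2. apply Hrel in H1, H2. apply Hfun with x; tauto.
  - intros x y z H1 H2. apply Hrel in H1, H2. apply Hinj with z; tauto.
Qed.

Section Injection.

Context {f a b : M} (Hf : IsInjection f a b).

Lemma injection_dom x y : Related f x y -> x ∈ a.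
Proof. intros H. eapply (relation_dom f a b); [apply Hf|eassumption]. Qed.

Lemma injection_cod x y : Related f x y -> y ∈ b.
Proof. intros H. eapply (relation_dom f a b); [apply Hf|eassumption]. Qed.

Lemma injection_total x : x ∈ a -> exists y, Related f x y.
Proof. apply Hf. Qed.

Lemma injection_functional x y z : Related f x y -> Related f x z -> y = z.
Proof. apply Hf. Qed.

Lemma injection_injective x y z : Related f x z -> Related f y z -> x = y.
Proof. apply Hf. Qed.

End Injection.

Lemma equipotent_sym a b : Equipotent a b -> Equipotent b a.
Proof.
  intros (f & Hf & Hsur).
  destruct (injection_comprehension (fun y x => Related f x y) b a) as (g & Hg & Hrel).
  - definable.
  - intros y Hy. destruct (Hsur y Hy) as [x Hx]. exists x. split; [|assumption].
    now apply (injection_dom Hf x y).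
  - intros y x x' _ _ _. apply (injection_injective Hf).
  - intros y y' x _ _ _. apply (injection_functional Hf).
  - exists g. split; [assumption|]. intros x Hx.
    destruct (injection_total Hf x Hx) as [y Hy]. exists y. apply Hrel.
    repeat split; eauto using injection_cod, injection_dom.
Qed.

(** * Natural numbers *)

(** Separated from any inductive set, as the intersection of all of them. *)
Lemma omega_exists : exists w, IsOmega w.
Proof.
  destruct inductive_set as [I HI].
  destruct (separation (fun n => forall i, IsInductive i -> n ∈ i) I) as [w Hw];
    [definable|].
  exists w. split; [split|].
  - destruct HI as [(e & He & HeI) _]. exists e. split; [assumption|]. apply Hw.
    split; [assumption|]. intros i [(e' & He' & Hi) _].
    replace e with e'; [assumption|]. apply extensionality. firstorder.
  - intros n Hn. apply Hw in Hn as [HnI Hn]. destruct (succ_set n) as [s Hs].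
    exists s. split; [assumption|].
    assert (K : forall i, IsInductive i -> n ∈ i -> s ∈ i).
    { intros i [_ Hi] Hni. destruct (Hi n Hni) as (s' & Hs' & H).
      now rewrite (succ_unique s s' n). }
    apply Hw. auto.
  - intros i Hi n Hn. apply Hw in Hn as [_ Hn]. auto.
Qed.

Section Omega.

Context {w : M} (Hw : IsOmega w).

Lemma omega_induction (P : M -> Prop) : definable 1 (fun r => P (r 0)) ->
  (forall e, IsEmpty e -> P e) ->
  (forall n s, n ∈ w -> IsSucc s n -> P n -> P s) ->
  forall n, n ∈ w -> P n.
Proof.
  intros HP H0 HS. destruct (separation P w HP) as [i Hi].
  assert (IsInductive i).
  { destruct Hw as [[(e & He & Hew) Hsucc] _]. split.
    - exists e. split; [assumption|]. apply Hi. auto.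
    - intros n Hn. apply Hi in Hn as [Hn HPn].
      destruct (Hsucc n Hn) as (s & Hs & Hsw). exists s. split; [assumption|].
      apply Hi. eauto. }
  intros n Hn. apply (proj2 Hw i) in Hn; [|assumption]. now apply Hi.
Qed.

Lemma omega_empty e : IsEmpty e -> e ∈ w.
Proof.
  intros He. destruct Hw as [[(e' & He' & H) _] _].
  replace e with e'; [assumption|]. apply extensionality. firstorder.
Qed.

Lemma omega_succ n s : n ∈ w -> IsSucc s n -> s ∈ w.
Proof.
  intros Hn Hs. destruct Hw as [[_ H] _]. destruct (H n Hn) as (s' & Hs' & Hsw).
  now rewrite (succ_unique s s' n).
Qed.

Lemma omega_transitive n i : n ∈ w -> i ∈ n -> i ∈ w.
Proof.
  intros Hn. revert n Hn i.
  apply (omega_induction (fun n => forall i, i ∈ n -> i ∈ w)); [definable|firstorder|].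
  intros n s Hn Hs IH i Hi. apply Hs in Hi as [Hi | ->]; auto.
Qed.

Lemma nat_transitive n i j : n ∈ w -> i ∈ n -> j ∈ i -> j ∈ n.
Proof.
  intros Hn. revert n Hn i j.
  apply (omega_induction (fun n => forall i j, i ∈ n -> j ∈ i -> j ∈ n));
    [definable|firstorder|].
  intros n s Hn Hs IH i j Hi Hj. apply Hs. left.
  apply Hs in Hi as [Hi | ->]; eauto.
Qed.

Lemma nat_irrefl n : n ∈ w -> ~ n ∈ n.
Proof.
  revert n. apply (omega_induction (fun n => ~ n ∈ n)); [definable|firstorder|].
  intros n s Hn Hs IH H. apply IH. assert (Hns : n ∈ s) by (apply Hs; now right).
  apply Hs in H as [H | <-]; [|assumption]. now apply nat_transitive with s.
Qed.

(** This replaces the linear order and the least number principle: the least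
    number with a property is the set of those [j] for which the property fails
    at [j] and at all its predecessors, and this set is an initial segment. *)
Lemma nat_initial_segment n t : n ∈ w -> Subset t n ->
  (forall i j, i ∈ t -> j ∈ i -> j ∈ t) -> t ∈ n \/ t = n.
Proof.
  intros Hn. revert n Hn t. apply (omega_induction (fun n => forall t, Subset t n ->
    (forall i j, i ∈ t -> j ∈ i -> j ∈ t) -> t ∈ n \/ t = n)); [definable| |].
  - intros e He t Ht _. right. apply extensionality. firstorder.
  - intros n s Hn Hs IH t Hts Ht. destruct (classic (n ∈ t)) as [Hnt|Hnt].
    + right. apply extensionality. intros x. split; [apply Hts|].
      intros Hx. apply Hs in Hx as [Hx | ->]; eauto.
    + left. apply Hs. apply IH; [|assumption]. intros x Hx.
      destruct (proj1 (Hs x) (Hts x Hx)) as [| ->]; tauto.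
Qed.

(** The intersection [k] of [m] and [n] is an initial segment of both, and it
    cannot be an element of both, since then it would be an element of itself. *)
Lemma nat_comparable m n : m ∈ w -> n ∈ w -> Subset m n \/ Subset n m.
Proof.
  intros Hm Hn. destruct (separation (fun i => i ∈ n) m) as [k Hk]; [definable|].
  assert (Ht : forall i j, i ∈ k -> j ∈ i -> j ∈ k).
  { intros i j Hi Hj. apply Hk in Hi as [Him Hin]. apply Hk.
    eauto using nat_transitive. }
  destruct (nat_initial_segment m k Hm) as [Hkm|E]; [firstorder|assumption| |].
  - destruct (nat_initial_segment n k Hn) as [Hkn|E]; [firstorder|assumption| |].
    + exfalso. apply (nat_irrefl k); [now apply omega_transitive with m|].
      now apply Hk.
    + right. intros x Hx. rewrite <- E in Hx. now apply Hk.
  - left. intros x Hx. rewrite <- E in Hx. now apply Hk.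
Qed.

Lemma succ_injective m n s : m ∈ w -> IsSucc s m -> IsSucc s n -> m = n.
Proof.
  intros Hm Hsm Hsn.
  destruct (proj1 (Hsn m) (proj2 (Hsm m) (or_intror eq_refl))) as [Hmn|]; [|assumption].
  destruct (proj1 (Hsm n) (proj2 (Hsn n) (or_intror eq_refl))) as [Hnm|]; [|now symmetry].
  exfalso. apply (nat_irrefl m Hm). now apply nat_transitive with n.
Qed.

Lemma nat_cases n : n ∈ w -> IsEmpty n \/ exists m, m ∈ w /\ IsSucc n m.
Proof.
  revert n. apply (omega_induction (fun n => IsEmpty n \/ exists m, m ∈ w /\ IsSucc n m));
    [definable|tauto|eauto].
Qed.

(** An injection [f] from [n + 2] to [n + 1] gives one from [n + 1] to [n] by
    sending the number whose value is [n], if there is one, to the value of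
    [f] at [n + 1]. *)
Lemma pigeonhole n s f : n ∈ w -> IsSucc s n -> ~ IsInjection f s n.
Proof.
  intros Hn. revert n Hn s f.
  apply (omega_induction (fun n => forall s f, IsSucc s n -> ~ IsInjection f s n));
    [definable| |].
  - intros e He s f Hs Hf.
    destruct (injection_total Hf e) as [y Hy]; [apply Hs; now right|].
    apply (injection_cod Hf) in Hy. now apply (He y).
  - intros n m Hn Hm IH s f Hs Hf.
    destruct (injection_comprehension
      (fun x y => Related f x y \/ (Related f x n /\ Related f m y)) m n)
      as (g & Hg & _); [definable| | | |now apply (IH m g)].
    + intros x Hx. assert (Hxs : x ∈ s) by (apply Hs; now left).
      destruct (injection_total Hf x Hxs) as [y Hy].
      destruct (proj1 (Hm y) (injection_cod Hf x y Hy)) as [Hyn | ->]; [eauto|].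
      destruct (injection_total Hf m) as [z Hz]; [apply Hs; now right|].
      destruct (proj1 (Hm z) (injection_cod Hf m z Hz)) as [Hzn | ->]; [eauto|].
      exfalso. apply (nat_irrefl m); [now apply (omega_succ n)|].
      rewrite (injection_injective Hf m x n) at 1 by assumption. assumption.
    + intros x y z Hx Hy Hz [H1|[H1 H2]] [H3|[H3 H4]].
      * now apply (injection_functional Hf x).
      * exfalso. rewrite (injection_functional Hf x y n) in Hy by assumption.
        now apply (nat_irrefl n).
      * exfalso. rewrite (injection_functional Hf x z n) in Hz by assumption.
        now apply (nat_irrefl n).
      * now apply (injection_functional Hf m).
    + assert (C : forall x z, x ∈ m -> Related f x z -> Related f m z -> False).
      { intros x z Hx H1 H2. apply (nat_irrefl m); [now apply (omega_succ n)|].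
        rewrite (injection_injective Hf m x z) at 1 by assumption. assumption. }
      intros x y z Hx Hy Hz [H1|[H1 H2]] [H3|[H3 H4]].
      * now apply (injection_injective Hf x y z).
      * exfalso. eauto.
      * exfalso. eauto.
      * now apply (injection_injective Hf x y n).
Qed.

Lemma extend_injection n s f X x : n ∈ w -> IsSucc s n -> IsInjection f n X ->
  x ∈ X -> (forall k, ~ Related f k x) ->
  exists g, IsInjection g s X /\
    forall k y, Related g k y <-> Related f k y \/ (k = n /\ y = x).
Proof.
  intros Hn Hs Hf Hx Hfx.
  destruct (injection_comprehension (fun k y => Related f k y \/ (k = n /\ y = x)) s X)
    as (g & Hg & Hrel).
  - definable.
  - intros k Hk. apply Hs in Hk as [Hk | ->]; [|eauto].
    destruct (injection_total Hf k Hk) as [y Hy].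
    exists y. split; [now apply (injection_cod Hf k)|now left].
  - assert (C : forall y, ~ Related f n y).
    { intros y Hy. now apply (nat_irrefl n Hn), (injection_dom Hf n y). }
    intros k y z _ _ _ [H1| [ -> ->]] [H2|[E ->]]; subst; try (exfalso; eapply C; eassumption).
    + now apply (injection_functional Hf k).
    + reflexivity.
  - intros j k y _ _ _ [H1| [ -> ->]] [H2| [ -> E]]; subst; try (exfalso; eapply Hfx; eassumption).
    + now apply (injection_injective Hf j k y).
    + reflexivity.
  - exists g. split; [assumption|]. intros k y. rewrite Hrel. split; [tauto|].
    intros H. repeat split; trivial.
    + apply Hs. destruct H as [H| [ -> _]]; [left|now right].
      now apply (injection_dom Hf k y).
    + destruct H as [H|[_ ->]]; [|assumption]. now apply (injection_cod Hf k).
Qed.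

(** * Injective recursion *)

(** Course-of-values recursion: [Step s k x] is to be read as [x] being the value
    at [k] when the values below [k] are those of [s]. By [Step_total] the new
    value differs from the earlier ones as long as these differ from each other,
    so that all approximations are injections. *)
Section Recursion.

Context {X : M} {Step : M -> M -> M -> Prop}.
Context (Step_definable : definable 3 (fun r => Step (r 0) (r 1) (r 2))).
Context (Step_local : forall s s' k x, k ∈ w ->
  (forall i y, i ∈ k -> Related s i y <-> Related s' i y) ->
  Step s k x -> Step s' k x).
Context (Step_functional : forall s k x x', k ∈ w ->
  Step s k x -> Step s k x' -> x = x').
Context (Step_total : forall s k, k ∈ w -> IsInjection s k X ->
  exists x, x ∈ X /\ Step s k x /\ forall i, ~ Related s i x).

Definition Approximation (n s : M) : Prop :=
  IsInjection s n X /\ forall k x, Related s k x -> Step s k x.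

(** Induction on [m]: below [m] the two agree, so [Step_local] and
    [Step_functional] force the same value at [m]. *)
Lemma approximations_agree n s n' s' k x : n ∈ w -> n' ∈ w ->
  Approximation n s -> Approximation n' s' -> Subset n n' ->
  Related s k x -> Related s' k x.
Proof.
  intros Hn Hn' Hs Hs' Hsub Hkx.
  assert (Hk : k ∈ n) by (apply (injection_dom (proj1 Hs) k x Hkx)).
  revert Hk Hkx. revert k x.
  enough (H : forall m, m ∈ w -> Subset m n -> forall k x, k ∈ m ->
    Related s k x <-> Related s' k x) by (intros; now apply (H n Hn (fun _ h => h) k)).
  apply (omega_induction (fun m => Subset m n -> forall k x, k ∈ m ->
    Related s k x <-> Related s' k x)); [definable|firstorder|].
  intros m p Hm Hp IH Hpn k x Hk.
  assert (IH' : forall i y, i ∈ m -> Related s i y <-> Related s' i y).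
  { apply IH. intros i Hi. apply Hpn, Hp. now left. }
  apply Hp in Hk as [Hk| ->]; [now apply IH'|].
  assert (Hmn : m ∈ n) by (apply Hpn, Hp; now right).
  destruct (injection_total (proj1 Hs) m Hmn) as [y Hy].
  destruct (injection_total (proj1 Hs') m (Hsub m Hmn)) as [y' Hy'].
  assert (E : y = y').
  { apply (Step_functional s' m); [assumption| |now apply Hs'].
    apply (Step_local s); [assumption|assumption|now apply Hs]. }
  subst y'. split; intros H.
  - now rewrite (injection_functional (proj1 Hs) m x y).
  - now rewrite (injection_functional (proj1 Hs') m x y).
Qed.

Lemma approximation_exists n : n ∈ w -> exists s, Approximation n s.
Proof.
  revert n. apply (omega_induction (fun n => exists s, Approximation n s)).
  - unfold Approximation. definable.
  - intros e He. destruct (injection_comprehension (fun _ _ => False) e X) as (s & Hs & Hrel);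
      [definable|firstorder..|].
    exists s. split; [assumption|]. intros k x H. apply Hrel in H. tauto.
  - intros n p Hn Hp (s & Hs & HStep).
    destruct (Step_total s n Hn Hs) as (x & Hx & Hnx & Hfresh).
    destruct (extend_injection n p s X x) as (g & Hg & Hrel); trivial.
    exists g. split; [assumption|].
    assert (Hagree : forall k, k ∈ w -> (k = n \/ k ∈ n) ->
      forall i y, i ∈ k -> Related s i y <-> Related g i y).
    { intros k Hkw Hk i y Hi. rewrite Hrel. split; [tauto|].
      intros [H| [ -> _]]; [assumption|]. exfalso. apply (nat_irrefl n Hn).
      destruct Hk as [ -> | Hk]; [assumption|]. now apply nat_transitive with k. }
    intros k y Hky. apply Hrel in Hky as [H| [ -> ->]].
    + assert (Hk : k ∈ n) by (now apply (injection_dom Hs k y)).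
      assert (k ∈ w) by (now apply omega_transitive with n).
      apply (Step_local s); [assumption|apply Hagree; auto|auto].
    + apply (Step_local s); [assumption|apply Hagree; auto|assumption].
Qed.

(** The union of the approximations, any two of which are comparable. *)
Lemma injective_recursion : exists f, IsInjection f w X.
Proof.
  destruct (injection_comprehension (fun k x => exists n s,
    n ∈ w /\ Approximation n s /\ Related s k x) w X) as (f & Hf & _);
    [ | | | |now exists f].
  - unfold Approximation. definable.
  - intros k Hk. destruct (succ_set k) as [n Hn].
    assert (Hnw : n ∈ w) by (now apply omega_succ with k).
    destruct (approximation_exists n Hnw) as [s Hs].
    destruct (injection_total (proj1 Hs) k) as [x Hx]; [apply Hn; now right|].
    exists x. split; [now apply (injection_cod (proj1 Hs) k)|eauto].
  - intros k x x' _ _ _ (n & s & Hn & Hs & H) (n' & s' & Hn' & Hs' & H').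
    destruct (nat_comparable n n' Hn Hn').
    + apply (injection_functional (proj1 Hs') k); [|assumption].
      now apply (approximations_agree n s n' s').
    + apply (injection_functional (proj1 Hs) k); [assumption|].
      now apply (approximations_agree n' s' n s).
  - intros k k' x _ _ _ (n & s & Hn & Hs & H) (n' & s' & Hn' & Hs' & H').
    destruct (nat_comparable n n' Hn Hn').
    + apply (injection_injective (proj1 Hs') k k' x); [|assumption].
      now apply (approximations_agree n s n' s').
    + apply (injection_injective (proj1 Hs) k k' x); [assumption|].
      now apply (approximations_agree n' s' n s).
Qed.

End Recursion.

(** * The implications between the notions of infinity *)

(** An injection of [n] into [X] that is onto would make [X] finite, so there is
    always a value left for [n] itself. *)
Lemma finite_injections X : StandardInfinite mem X ->
  forall n, n ∈ w -> exists f, IsInjection f n X.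
Proof.
  intros HX. apply (omega_induction (fun n => exists f, IsInjection f n X)).
  - definable.
  - intros e He.
    destruct (injection_comprehension (fun _ _ => False) e X) as (s & Hs & _);
      [definable|firstorder..|now exists s].
  - intros n p Hn Hp [f Hf].
    destruct (classic (forall x, x ∈ X -> exists k, Related f k x)) as [Hsur|Hsur].
    + exfalso. apply HX. exists w. split; [assumption|]. exists n.
      split; [assumption|]. apply equipotent_sym. now exists f.
    + apply not_all_ex_not in Hsur as [x Hx].
      apply imply_to_and in Hx as [Hx Hfresh].
      destruct (extend_injection n p f X x) as (g & Hg & _); eauto.
Qed.

(** All injections of a number into [X] belong to one set, the power set of the
    product of [w] and [X], as countable choice requires. *)
Lemma chosen_injections X : StandardInfinite mem X ->
  exists F b, IsFunction F w b /\ forall k, k ∈ w ->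
    exists phi s, Related F k phi /\ IsSucc s k /\ IsInjection phi s X.
Proof.
  intros HX.
  destruct (relation_comprehension (fun _ _ => True) w X) as (c & _ & Hc).
  { (* [True], written as an implication to be within reach of the search *)
    apply definable_iff with (fun _ => False -> False); [tauto|definable]. }
  destruct (power_set c) as [b Hb].
  destruct (relation_comprehension
    (fun k phi => exists s, IsSucc s k /\ IsInjection phi s X) w b) as (P & HP & Prel);
    [definable|].
  destruct (countable_choice w b P Hw HP) as (F & HF & Fspec).
  - intros k Hk. destruct (succ_set k) as [s Hs].
    assert (Hsw : s ∈ w) by (now apply omega_succ with k).
    destruct (finite_injections X HX s Hsw) as [phi Hphi].
    assert (Hphib : phi ∈ b).
    { apply Hb. intros p Hp.
      destruct (proj1 (proj1 Hphi) p Hp) as (i & x & Hi & Hx & Hpix).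
      destruct (proj2 (Hc i x)) as (p' & Hp' & Hpc).
      - repeat split; trivial. now apply omega_transitive with s.
      - now rewrite (opair_unique p p' i x). }
    exists phi. split; [assumption|]. apply Prel. eauto.
  - exists F, b. split; [assumption|]. intros k Hk.
    destruct (Fspec k Hk) as (phi & Hphi & HPphi).
    apply Prel in HPphi as (_ & _ & s & Hs & Hinj). eauto.
Qed.

Section Step.

Context {F b X : M} (HF : IsFunction F w b).
Context (F_spec : forall k, k ∈ w ->
  exists phi s, Related F k phi /\ IsSucc s k /\ IsInjection phi s X).

Definition Hit (s k phi j : M) : Prop :=
  exists y i, Related phi j y /\ i ∈ k /\ Related s i y.

(** The number [t] is the least [j] up to [k] with the [j]-th entry of [phi] not
    among the values of [s], if there is one, given as the set of its
    predecessors. In this form it is unique by extensionality. *)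
Definition FirstMiss (s k phi t : M) : Prop :=
  forall j, j ∈ t <-> (j ∈ k \/ j = k) /\
    forall j', (j' ∈ j \/ j' = j) -> Hit s k phi j'.

Definition NextValue (s k x : M) : Prop :=
  exists phi t, Related F k phi /\ FirstMiss s k phi t /\ Related phi t x.

Lemma next_value_definable : definable 3 (fun r => NextValue (r 0) (r 1) (r 2)).
Proof. unfold NextValue, FirstMiss, Hit. definable. Qed.

Lemma next_value_local s s' k x :
  (forall i y, i ∈ k -> Related s i y <-> Related s' i y) ->
  NextValue s k x -> NextValue s' k x.
Proof.
  intros E (phi & t & Hphi & Ht & Hx). exists phi, t. repeat split; trivial.
  - now apply Ht.
  - intros j' Hj'. destruct (proj2 (proj1 (Ht j) H) j' Hj') as (y & i & Hy & Hi & H').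
    exists y, i. repeat split; trivial. now apply E.
  - intros [Hj H]. apply Ht. split; [assumption|]. intros j' Hj'.
    destruct (H j' Hj') as (y & i & Hy & Hi & H').
    exists y, i. repeat split; trivial. now apply E.
Qed.

Lemma next_value_functional s k x x' : k ∈ w ->
  NextValue s k x -> NextValue s k x' -> x = x'.
Proof.
  intros Hk (phi & t & Hphi & Ht & Hx) (phi' & t' & Hphi' & Ht' & Hx').
  destruct (F_spec k Hk) as (phi0 & s0 & Hphi0 & _ & Hinj).
  assert (phi' = phi0) as -> by (now apply (proj2 (proj2 HF)) with k).
  assert (phi = phi0) as -> by (now apply (proj2 (proj2 HF)) with k).
  assert (t' = t) as ->.
  { apply extensionality. intros j. now rewrite (Ht j), (Ht' j). }
  now apply (injection_functional Hinj t).
Qed.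

(** If no [t] up to [k] were a miss, all [k + 1] entries of [phi] would be among
    the [k] values of [s]; sending an entry to its place in [s] contradicts the
    pigeonhole principle. *)
Lemma next_value_total s k : k ∈ w -> IsInjection s k X ->
  exists x, x ∈ X /\ NextValue s k x /\ forall i, ~ Related s i x.
Proof.
  intros Hk Hs. destruct (F_spec k Hk) as (phi & K & Hphi & HK & Hinj).
  assert (HKw : K ∈ w) by (now apply omega_succ with k).
  destruct (separation (fun j => forall j', (j' ∈ j \/ j' = j) -> Hit s k phi j') K)
    as [t Ht]; [unfold Hit; definable|].
  assert (Hfirst : FirstMiss s k phi t).
  { intros j. rewrite (Ht j), (HK j). reflexivity. }
  destruct (nat_initial_segment K t HKw) as [HtK|E].
  - intros j Hj. now apply Ht.
  - intros i j Hi Hj. apply Ht in Hi as [Hi H].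
    assert (Hiw : i ∈ w) by (now apply omega_transitive with K).
    apply Ht. split; [now apply nat_transitive with i|].
    intros j' [Hj'| ->]; apply H; left; [now apply nat_transitive with j|assumption].
  - destruct (injection_total Hinj t HtK) as [x Hx]. exists x.
    split; [now apply (injection_cod Hinj t)|]. split; [now exists phi, t|].
    intros i Hi. apply (nat_irrefl t); [now apply omega_transitive with K|].
    apply Ht. split; [assumption|]. intros j' [Hj'| ->].
    + apply Ht in Hj' as [_ H]. apply H. now right.
    + exists x, i. repeat split; trivial. now apply (injection_dom Hs i x).
  - (* [t] is all of [K], so that every entry of [phi] is a value of [s] *)
    exfalso.
    destruct (injection_comprehension (fun j i => exists y, Related phi j y /\ Related s i y)
      K k) as (g & Hg & _); [definable| | | |now apply (pigeonhole k K g)].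
    + intros j Hj. rewrite <- E in Hj. apply Ht in Hj as [_ Hj].
      destruct (Hj j (or_intror eq_refl)) as (y & i & Hy & Hi & Hsi). eauto.
    + intros j i i' _ _ _ (y & Hy & Hi) (y' & Hy' & Hi').
      rewrite (injection_functional Hinj j y' y) in Hi' by assumption.
      now apply (injection_injective Hs i i' y).
    + intros j j' i _ _ _ (y & Hy & Hi) (y' & Hy' & Hi').
      rewrite (injection_functional Hs i y' y) in Hy' by assumption.
      now apply (injection_injective Hinj j j' y).
Qed.

End Step.

Lemma cardinal_of_standard X : StandardInfinite mem X -> CardinalInfinite mem X.
Proof.
  intros HX. exists w. split; [assumption|].
  destruct (chosen_injections X HX) as (F & b & HF & F_spec).
  apply (injective_recursion (Step := NextValue (F := F))).
  - apply next_value_definable.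
  - intros s s' k x _. apply next_value_local.
  - intros s k x x'. now apply (next_value_functional HF F_spec).
  - intros s k. apply (next_value_total F_spec).
Qed.

End Omega.

Lemma cantor_of_cardinal X : CardinalInfinite mem X -> CantorInfinite mem X.
Proof.
  intros (w & Hw & f & Hf).
  destruct (separation (fun x => exists n, Related f n x) X) as [B HB]; [definable|].
  exists B. split; [firstorder|]. exists w. split; [assumption|]. apply equipotent_sym.
  destruct (injection_comprehension (fun n x => Related f n x) w B) as (g & Hg & Hrel).
  - definable.
  - intros n Hn. destruct (injection_total Hf n Hn) as [x Hx]. exists x.
    split; [|assumption]. apply HB. split; [now apply (injection_cod Hf n)|eauto].
  - intros n x y _ _ _. apply (injection_functional Hf).
  - intros m n x _ _ _. apply (injection_injective Hf).
  - exists g. split; [assumption|]. intros x Hx.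
    destruct (proj1 (HB x) Hx) as (_ & n & Hn). exists n. apply Hrel.
    repeat split; trivial. now apply (injection_dom Hf n x).
Qed.

(** [X] is mapped onto [X] without [x0], the point numbered by zero, by moving
    each point of [B] to the one with the next number. *)
Lemma dedekind_of_cantor X : CantorInfinite mem X -> DedekindInfinite mem X.
Proof.
  intros (B & HBX & w & Hw & f & Hf & Hsur).
  destruct empty_set as [e He]. assert (Hew : e ∈ w) by (now apply omega_empty).
  destruct (Hsur e Hew) as [x0 Hx0].
  assert (Hx0X : x0 ∈ X) by (now apply HBX, (injection_dom Hf x0 e)).
  destruct (separation (fun x => ~ x = x0) X) as [C HC]; [definable|].
  exists C. split.
  { split; [firstorder|]. intros ->. now apply (proj1 (HC x0) Hx0X). }
  apply equipotent_sym.
  destruct (injection_comprehension (fun x y => (~ x ∈ B /\ x = y) \/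
    exists n s, Related f x n /\ IsSucc s n /\ Related f y s) X C) as (g & Hg & Hrel).
  - definable.
  - intros x Hx. destruct (classic (x ∈ B)) as [HxB|HxB].
    + destruct (injection_total Hf x HxB) as [n Hn]. destruct (succ_set n) as [s Hs].
      assert (Hsw : s ∈ w).
      { apply (omega_succ Hw n); [|assumption]. now apply (injection_cod Hf x). }
      destruct (Hsur s Hsw) as [y Hy]. exists y. split; [|right; eauto].
      apply HC. split; [now apply HBX, (injection_dom Hf y s)|]. intros ->.
      rewrite (injection_functional Hf x0 s e) in Hs by assumption.
      apply (He n), Hs. now right.
    + exists x. split; [|now left]. apply HC. split; [assumption|]. intros ->.
      now apply HxB, (injection_dom Hf x0 e).
  - intros x y z Hx Hy Hz [[H1 E1]|(n & s & H1 & Hs & H2)]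
      [[H3 E2]|(n' & s' & H3 & Hs' & H4)].
    + congruence.
    + exfalso. now apply H1, (injection_dom Hf x n').
    + exfalso. now apply H3, (injection_dom Hf x n).
    + rewrite (injection_functional Hf x n' n) in Hs' by assumption.
      rewrite (succ_unique s' s n) in H4 by assumption.
      now apply (injection_injective Hf y z s).
  - intros x y z Hx Hy Hz [[H1 ->]|(n & s & H1 & Hs & H2)]
      [[H3 E2]|(n' & s' & H3 & Hs' & H4)].
    + now symmetry.
    + exfalso. now apply H1, (injection_dom Hf z s').
    + subst y. exfalso. now apply H3, (injection_dom Hf z s).
    + rewrite (injection_functional Hf z s' s) in Hs' by assumption.
      assert (n = n') as <-.
      { apply (succ_injective Hw n n' s); trivial. now apply (injection_cod Hf x). }
      now apply (injection_injective Hf x y n).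
  - exists g. split; [assumption|]. intros y Hy. apply HC in Hy as [HyX Hy].
    assert (HyC : y ∈ C) by (now apply HC).
    destruct (classic (y ∈ B)) as [HyB|HyB]; [|exists y; apply Hrel; tauto].
    destruct (injection_total Hf y HyB) as [s Hs].
    assert (Hsw : s ∈ w) by (now apply (injection_cod Hf y)).
    destruct (nat_cases Hw s Hsw) as [H|(n & Hn & Hsn)].
    + exfalso. apply Hy. apply (injection_injective Hf y x0 s); [assumption|].
      replace s with e; [assumption|]. apply extensionality. firstorder.
    + destruct (Hsur n Hn) as [x Hx]. exists x. apply Hrel.
      repeat split; [|assumption|right; eauto].
      now apply HBX, (injection_dom Hf x n).
Qed.

(** Composing the bijections [X ~ n], [B ~ X] gives an injection of [n] into
    itself that misses the number of a point outside [B]; that number is free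
    to be the value at [n]. *)
Lemma standard_of_dedekind X : DedekindInfinite mem X -> StandardInfinite mem X.
Proof.
  intros (B & [HBX HBne] & HB) (w & Hw & n & Hn & phi & Hphi & Hphi_sur).
  apply equipotent_sym in HB as (b & Hb & Hb_sur).
  assert (exists x0, x0 ∈ X /\ ~ x0 ∈ B) as (x0 & Hx0 & Hx0B).
  { apply NNPP. intros C. apply HBne, extensionality. intros x. split; [apply HBX|].
    intros Hx. apply NNPP. intros HxB. apply C. eauto. }
  destruct (succ_set n) as [s Hs].
  destruct (injection_comprehension (fun i j => exists y, Related phi y j /\
    ((i = n /\ y = x0) \/ exists x, Related phi x i /\ Related b x y)) s n)
    as (g & Hg & _); [definable| | | |now apply (pigeonhole Hw n s g)].
  - intros i Hi.
    assert (exists y, y ∈ X /\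
      ((i = n /\ y = x0) \/ exists x, Related phi x i /\ Related b x y)) as (y & Hy & H).
    { apply Hs in Hi as [Hi| ->]; [|eauto]. destruct (Hphi_sur i Hi) as [x Hx].
      destruct (injection_total Hb x) as [y Hy]; [now apply (injection_dom Hphi x i)|].
      exists y. split; [now apply HBX, (injection_cod Hb x)|eauto]. }
    destruct (injection_total Hphi y Hy) as [j Hj]. exists j.
    split; [now apply (injection_cod Hphi y)|eauto].
  - assert (C : forall x, ~ Related phi x n).
    { intros x Hx. now apply (nat_irrefl Hw n Hn), (injection_cod Hphi x). }
    intros i j k _ _ _ (y & Hyj & H) (z & Hzk & H').
    enough (y = z) as <- by now apply (injection_functional Hphi y).
    destruct H as [[E ->]|(x & Hx & Hxy)], H' as [[E' ->]|(x' & Hx' & Hxz)];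
      subst; try (exfalso; eapply C; eassumption); [reflexivity|].
    rewrite (injection_injective Hphi x' x i) in Hxz by assumption.
    now apply (injection_functional Hb x).
  - assert (C : forall x, ~ Related b x x0).
    { intros x Hx. now apply Hx0B, (injection_cod Hb x). }
    intros i j k _ _ _ (y & Hyj & H) (z & Hzk & H').
    assert (z = y) as -> by now apply (injection_injective Hphi z y k).
    destruct H as [[E ->]|(x & Hx & Hxy)], H' as [[E' E'']|(x' & Hx' & Hxz)];
      subst; try (exfalso; eapply C; eassumption); [reflexivity|].
    rewrite (injection_injective Hb x' x y) in Hx' by assumption.
    now apply (injection_functional Hphi x).
Qed.

Theorem infinity_equivalences X :
  (StandardInfinite mem X <-> CardinalInfinite mem X) /\
  (CardinalInfinite mem X <-> CantorInfinite mem X) /\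
  (CantorInfinite mem X <-> DedekindInfinite mem X).
Proof.
  destruct omega_exists as [w Hw].
  pose proof (cardinal_of_standard Hw X). pose proof (cantor_of_cardinal X).
  pose proof (dedekind_of_cantor X). pose proof (standard_of_dedekind X). tauto.
Qed.

End Model.

Lemma bound_closure p : bound (closure p) = 0.
Proof.
  enough (H : forall n, bound (Nat.iter n All p) = bound p - n).
  { unfold closure. rewrite H. lia. }
  induction n as [|n IH]; simpl; [lia|]. rewrite IH. lia.
Qed.

Lemma Z_ACω_closed q : Z_ACω q -> bound q = 0.
Proof.
  intros [[]| ->]; try reflexivity. apply bound_closure.
Qed.

Local Open Scope pform_scope.

Theorem theorem3p1 :
  provable Z_ACω
    (sentence (∀ X,
       (standard_infinite X ⟷ cardinal_infinite X) ∧
       (cardinal_infinite X ⟷ cantor_infinite X) ∧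
       (cantor_infinite X ⟷ dedekind_infinite X))).
Proof.
  apply completeness; [exact Z_ACω_closed|reflexivity|].
  intros M mem rho axioms.
  match goal with |- ?A => assert (E : A <-> forall X,
    (StandardInfinite mem X <-> CardinalInfinite mem X) /\
    (CardinalInfinite mem X <-> CantorInfinite mem X) /\
    (CantorInfinite mem X <-> DedekindInfinite mem X)) by reflect end.
  apply E. exact (infinity_equivalences mem rho axioms).
Qed.
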